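(* Let $n$ be an odd integer and let $a$ be a nonzero real number. Then $$\int_0^{1}\frac{\sin \bigl(n \sin^{-1}t\bigr)\,\sinh \bigl(n \sinh^{-1}(t/a)\bigr)}{\cos \bigl( 2 n \sin^{-1}t\bigr)+\cosh \bigl(2 n \sinh^{-1}(t/a)\bigr)}\;\frac{dt}{t\, \sqrt{1-t^2}\, \sqrt{1+t^2/a^2}}=\frac{\tan^{-1} a}{2}.$$
   Context: Here $\sin^{-1}$, $\sinh^{-1}$, $\tan^{-1}$ denote the (principal) inverse functions $\arcsin$, $\operatorname{arcsinh}$, $\arctan$, not reciprocals. *)

(* Defs.v *)
From Stdlib Require Export Reals ZArith.
From Coquelicot Require Export Coquelicot.

(* Main.v *)
Require Import Defs.
From Stdlib Require Import Reals ZArith Lra Lia.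
From Coquelicot Require Import Coquelicot.
Open Scope R_scope.

(** Take [a > 0], [m = 1 / a], [n > 0], and let [z = asin t + i arcsinh (m t)].  The integrand is the
    [dt]-component of the closed form [Im (dz / (sin z cos (n z))) / 2] pulled back to the
    [(m, t)]-half-strip [0 < m], [0 < t < 1], where [cos (n z)] does not vanish.  Hence its integral
    over [x, y] changes with [m] only through the [dm]-component [g (m, t)] at [t = x] and [t = y].
    As [m -> oo] the integral over [x, y] vanishes; as [y -> 1], [g (m, y) -> 0] because [n] is odd;
    as [x -> 0], [g (m, x) -> 1 / (2 (1 + m^2))].  So the integral is
    [(PI / 2 - atan m) / 2 = atan a / 2]. *)

(** * Integrals of a closed form along the sides of a rectangle *)

Lemma continuity_2d_section (F : R -> R -> R) (m t : R) :
  continuity_2d_pt F m t -> continuous (F m) t.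
Proof.
  intros H; apply continuity_pt_filterlim; intros eps Heps.
  destruct (H (mkposreal eps Heps)) as [d Hd].
  exists d; split; [apply cond_pos|].
  intros x [_ Hx]; apply Hd; [|exact Hx].
  rewrite Rminus_diag, Rabs_R0; apply cond_pos.
Qed.

(** Green's theorem for the closed form [f dt + g dm]. Differentiating under the integral sign, the
    [m]-derivative of the integral of [f m] is the integral of [F m] over [[c, d]], which is
    [g m d - g m c] because [F m] is also the derivative of [g m]. A second use of the fundamental
    theorem, now in [m], concludes. *)
Lemma closed_form_RInt (f g F : R -> R -> R) (U V : R -> Prop) (a b c d : R) :
  open U -> open V ->
  (forall m t, U m -> V t -> is_derive (fun u => f u t) m (F m t)) ->
  (forall m t, U m -> V t -> is_derive (g m) t (F m t)) ->
  (forall m t, U m -> V t -> continuity_2d_pt F m t) ->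
  (forall m t, U m -> V t -> continuous (f m) t) ->
  (forall m t, U m -> V t -> continuous (fun u => g u t) m) ->
  c <= d ->
  (forall m, Rmin a b <= m <= Rmax a b -> U m) ->
  (forall t, c <= t <= d -> V t) ->
  is_RInt (fun m => g m d - g m c) a b (RInt (f b) c d - RInt (f a) c d).
Proof.
  intros HU HV Hf Hg HF Cf Cg Hcd Hab HcdV.
  assert (Hint : forall m, U m -> ex_RInt (f m) c d).
  { intros m Hm; apply (ex_RInt_continuous (V := R_CompleteNormedModule)); intros t Ht.
    rewrite Rmin_left, Rmax_right in Ht by exact Hcd. now apply Cf; auto. }
  apply (is_RInt_derive (V := R_CompleteNormedModule) (fun m => RInt (f m) c d)
          (fun m => g m d - g m c)).
  - intros m Hm. specialize (Hab m Hm).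
    assert (E : RInt (fun t => Derive (fun u => f u t) m) c d = g m d - g m c).
    { rewrite (RInt_ext _ (F m)).
      - apply is_RInt_unique.
        apply (is_RInt_derive (V := R_CompleteNormedModule) (g m) (F m)); intros t Ht;
          rewrite Rmin_left, Rmax_right in Ht by exact Hcd.
        + auto.
        + apply continuity_2d_section; auto.
      - intros t Ht. rewrite Rmin_left, Rmax_right in Ht by exact Hcd.
        apply is_derive_unique, Hf; [exact Hab|apply HcdV; lra]. }
    rewrite <- E. apply (is_derive_RInt_param f).
    + apply (filter_imp U); [|now apply HU].
      intros x Hx t Ht. rewrite Rmin_left, Rmax_right in Ht by exact Hcd.
      exists (F x t). now apply Hf; auto.
    + intros t Ht. rewrite Rmin_left, Rmax_right in Ht by exact Hcd.
      (* [Derive] agrees with [F] only where both [U] and [V] hold, so continuity is transferred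
         from [F] on a small square inside the two open sets. *)
      apply (continuity_2d_pt_ext_loc F); [|now apply HF; auto].
      destruct (HU m Hab) as [e1 H1]. destruct (HV t (HcdV t Ht)) as [e2 H2].
      exists (mkposreal _ (Rmin_stable_in_posreal e1 e2)). cbn. intros u v Hu Hv.
      symmetry; apply is_derive_unique, Hf.
      * apply H1. eapply Rlt_le_trans; [exact Hu|apply Rmin_l].
      * apply H2. eapply Rlt_le_trans; [exact Hv|apply Rmin_r].
    + apply (filter_imp U); [|now apply HU]. exact Hint.
  - intros m Hm. specialize (Hab m Hm).
    apply (continuous_minus (V := R_NormedModule) (fun m => g m d) (fun m => g m c));
      apply Cg; auto; apply HcdV; lra.
Qed.

(** * Derivatives of the inverse and multiple-angle functions *)

Lemma is_derive_sinh (x : R) : is_derive sinh x (cosh x).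
Proof. apply is_derive_Reals, derivable_pt_lim_sinh. Qed.

Lemma is_derive_cosh (x : R) : is_derive cosh x (sinh x).
Proof. apply is_derive_Reals, derivable_pt_lim_cosh. Qed.

Lemma is_derive_arcsinh (x : R) : is_derive arcsinh x (/ sqrt (1 + x ^ 2)).
Proof.
  rewrite Rplus_comm. apply is_derive_Reals, derivable_pt_lim_arcsinh.
Qed.

Lemma is_derive_asin (t : R) : -1 < t < 1 -> is_derive asin t (/ sqrt (1 - t ^ 2)).
Proof.
  intros Ht. apply is_derive_Reals.
  replace (/ sqrt (1 - t ^ 2)) with (derive_pt asin t (derivable_pt_asin t Ht)).
  - apply (derive_pt_eq_1 _ _ _ (derivable_pt_asin t Ht)); reflexivity.
  - rewrite derive_pt_asin. unfold Rsqr, Rdiv. rewrite Rmult_1_l. do 3 f_equal. ring.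
Qed.

Lemma cosh2_sinh2 (x : R) : cosh x * cosh x = 1 + sinh x * sinh x.
Proof.
  unfold cosh, sinh.
  assert (E : exp x * exp (- x) = 1) by (rewrite <- exp_plus, Rplus_opp_r; apply exp_0).
  replace 1 with (exp x * exp (- x)) by exact E. field.
Qed.

(** For [z = asin t + i arcsinh w], [sin (n z) = sn * ch + i cn * sh] and
    [cos (n z) = cn * ch - i sn * sh]. The multiplier [n] is real here; integrality enters only
    through the endpoint bounds on [sn] and [cn]. *)
Definition sn (n t : R) : R := sin (n * asin t).
Definition cn (n t : R) : R := cos (n * asin t).
Definition sh (n w : R) : R := sinh (n * arcsinh w).
Definition ch (n w : R) : R := cosh (n * arcsinh w).

Lemma sn2_cn2 (n t : R) : sn n t * sn n t = 1 - cn n t * cn n t.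
Proof. generalize (sin2_cos2 (n * asin t)). unfold sn, cn, Rsqr. lra. Qed.

Lemma ch2_sh2 (n w : R) : ch n w * ch n w = 1 + sh n w * sh n w.
Proof. apply cosh2_sinh2. Qed.

Lemma is_derive_sn (n t : R) : -1 < t < 1 -> is_derive (sn n) t (n * cn n t / sqrt (1 - t ^ 2)).
Proof.
  intros Ht. unfold sn, cn. evar_last.
  - apply (is_derive_comp sin); [apply is_derive_sin|].
    apply (is_derive_scal asin). now apply is_derive_asin.
  - unfold scal; cbn; unfold mult; cbn. unfold Rdiv; ring.
Qed.

Lemma is_derive_cn (n t : R) : -1 < t < 1 -> is_derive (cn n) t (- n * sn n t / sqrt (1 - t ^ 2)).
Proof.
  intros Ht. unfold sn, cn. evar_last.
  - apply (is_derive_comp cos); [apply is_derive_cos|].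
    apply (is_derive_scal asin). now apply is_derive_asin.
  - unfold scal; cbn; unfold mult; cbn. unfold Rdiv; ring.
Qed.

Lemma is_derive_sh (n w : R) : is_derive (sh n) w (n * ch n w / sqrt (1 + w ^ 2)).
Proof.
  unfold sh, ch. evar_last.
  - apply (is_derive_comp sinh); [apply is_derive_sinh|].
    apply (is_derive_scal arcsinh). now apply is_derive_arcsinh.
  - unfold scal; cbn; unfold mult; cbn. unfold Rdiv; ring.
Qed.

Lemma is_derive_ch (n w : R) : is_derive (ch n) w (n * sh n w / sqrt (1 + w ^ 2)).
Proof.
  unfold sh, ch. evar_last.
  - apply (is_derive_comp cosh); [apply is_derive_cosh|].
    apply (is_derive_scal arcsinh). now apply is_derive_arcsinh.
  - unfold scal; cbn; unfold mult; cbn. unfold Rdiv; ring.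
Qed.

(** * The two components of the closed form, their common derivative and their continuity *)

(** [|cos (n z)|^2]. *)
Definition den (n m t : R) : R := cn n t * cn n t + sh n (m * t) * sh n (m * t).

(** This is the integrand of the theorem for [m = 1 / a]: the identity [cos (2 x) + cosh (2 y) = 2
    (cos x ^ 2 + sinh y ^ 2)] turns its denominator into [2 * den]. *)
Definition integrand (n m t : R) : R :=
  sn n t * sh n (m * t) /
  (2 * den n m t * t * sqrt (1 - t ^ 2) * sqrt (1 + (m * t) ^ 2)).

(** [Re (sin z cos (n z)) / (cosh (arcsinh (m t)) t |cos (n z)|^2)], which tends to [1] at [t = 0]. *)
Definition ratio (n m t : R) : R :=
  (cn n t * ch n (m * t)
   + m * sqrt (1 - t ^ 2) * sn n t * sh n (m * t) / sqrt (1 + (m * t) ^ 2))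
  / den n m t.

(** The [dm]-component of the closed form, using [|sin z|^2 = t^2 (1 + m^2)]. *)
Definition conj_integrand (n m t : R) : R := ratio n m t / (2 * (1 + m ^ 2)).

(** The common value of the [m]-derivative of [integrand] and the [t]-derivative of
    [conj_integrand]. *)
Definition mixed (n m t : R) : R :=
  sn n t / (2 * sqrt (1 - t ^ 2)) *
  (n * ch n (m * t) / ((1 + (m * t) ^ 2) * den n m t)
   - 2 * n * sh n (m * t) ^ 2 * ch n (m * t) / ((1 + (m * t) ^ 2) * den n m t ^ 2)
   - m * t * sh n (m * t) / (den n m t * (1 + (m * t) ^ 2) * sqrt (1 + (m * t) ^ 2))).

(** [sinh] is increasing and [arcsinh w <= n * arcsinh w]. This linear lower bound keeps [den]
    positive and later supplies the decay in [m]. *)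
Lemma sh_ge_id (n w : R) : 1 <= n -> 0 <= w -> w <= sh n w.
Proof.
  intros Hn Hw. unfold sh. rewrite <- (sinh_arcsinh w) at 1.
  assert (0 <= arcsinh w) by (rewrite <- arcsinh_0; now apply arcsinh_le).
  destruct (Rle_lt_or_eq_dec (arcsinh w) (n * arcsinh w)) as [L|E]; [nra| |].
  - left. now apply sinh_lt.
  - rewrite <- E. lra.
Qed.

Lemma den_pos (n m t : R) : 1 <= n -> 0 < m -> 0 < t -> 0 < den n m t.
Proof.
  intros Hn Hm Ht. unfold den.
  assert (0 < m * t) by nra.
  assert (m * t <= sh n (m * t)) by (apply sh_ge_id; lra). nra.
Qed.


Lemma is_derive_integrand (n m t : R) : 1 <= n -> 0 < m -> 0 < t < 1 ->
  is_derive (fun u => integrand n u t) m (mixed n m t).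
Proof.
  intros Hn Hm Ht. pose proof (den_pos n m t Hn Hm (proj1 Ht)) as HD.
  assert (Hc : 0 < sqrt (1 - t ^ 2)) by (apply sqrt_lt_R0; nra).
  assert (He1 : 0 < 1 + (m * t) ^ 2) by nra.
  assert (He : 0 < sqrt (1 + (m * t) ^ 2)) by (apply sqrt_lt_R0; nra).
  pose proof (sqrt_sqrt _ (Rlt_le _ _ He1)) as He2.
  pose proof (is_derive_sh n (m * t)) as Ds.
  pose proof (is_derive_unique _ _ _ Ds) as Es.
  unfold integrand, mixed, den in *.
  auto_derive.
  - change (t * (t * 1)) with (t ^ 2). change (m * t * (m * t * 1)) with ((m * t) ^ 2).
    repeat split; try (eexists; exact Ds); try nra.
    repeat apply Rmult_integral_contrapositive_currified; lra.
  - change (t * (t * 1)) with (t ^ 2). change (m * t * (m * t * 1)) with ((m * t) ^ 2).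
    change (fun x => sh n x) with (sh n). rewrite Es.
    revert HD He2 He He1 Hc.
    (* With the transcendental quantities as free variables and [1 + (m t) ^ 2] written as [e * e],
       a rational identity remains. *)
    generalize (sqrt (1 + (m * t) ^ 2)) (sqrt (1 - t ^ 2)) (sh n (m * t)) (ch n (m * t))
      (cn n t) (sn n t).
    intros e c s k C S HD He2 He He1 Hc.
    replace (1 + (m * t) ^ 2) with (e * e) by lra.
    field. repeat split; lra.
Qed.

(** Together with [is_derive_integrand] this is closedness. After clearing denominators the identity
    holds only modulo [sin ^ 2 + cos ^ 2 = 1], [cosh ^ 2 - sinh ^ 2 = 1] and the squares of the two
    roots; the final [ring] reduces by these four relations. *)
Lemma is_derive_conj_integrand (n m t : R) : 1 <= n -> 0 < m -> 0 < t < 1 ->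
  is_derive (conj_integrand n m) t (mixed n m t).
Proof.
  intros Hn Hm Ht. pose proof (den_pos n m t Hn Hm (proj1 Ht)) as HD.
  assert (Hc1 : 0 < 1 - t ^ 2) by nra.
  assert (Hc : 0 < sqrt (1 - t ^ 2)) by (apply sqrt_lt_R0; nra).
  assert (He1 : 0 < 1 + (m * t) ^ 2) by nra.
  assert (He : 0 < sqrt (1 + (m * t) ^ 2)) by (apply sqrt_lt_R0; nra).
  pose proof (sqrt_sqrt _ (Rlt_le _ _ He1)) as He2.
  pose proof (sqrt_sqrt _ (Rlt_le _ _ Hc1)) as Hc2.
  assert (Ht' : -1 < t < 1) by lra.
  pose proof (is_derive_sh n (m * t)) as Ds.
  pose proof (is_derive_unique _ _ _ Ds) as Es.
  pose proof (is_derive_ch n (m * t)) as Dk.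
  pose proof (is_derive_unique _ _ _ Dk) as Ek.
  pose proof (is_derive_sn n t Ht') as DS.
  pose proof (is_derive_unique _ _ _ DS) as ES.
  pose proof (is_derive_cn n t Ht') as DC.
  pose proof (is_derive_unique _ _ _ DC) as EC.
  pose proof (sn2_cn2 n t) as RS. pose proof (ch2_sh2 n (m * t)) as Rk.
  unfold conj_integrand, ratio, mixed, den in *.
  auto_derive.
  - change (t * (t * 1)) with (t ^ 2). change (m * t * (m * t * 1)) with ((m * t) ^ 2).
    change (1 + - t ^ 2) with (1 - t ^ 2).
    repeat split; try (eexists; eassumption); try nra.
  - change (t * (t * 1)) with (t ^ 2). change (m * t * (m * t * 1)) with ((m * t) ^ 2).
    change (1 + - t ^ 2) with (1 - t ^ 2).
    change (fun x => sh n x) with (sh n). change (fun x => ch n x) with (ch n).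
    change (fun x => sn n x) with (sn n). change (fun x => cn n x) with (cn n).
    rewrite Es, Ek, ES, EC.
    revert HD He2 He He1 Hc Hc1 Hc2 RS Rk. clear Ds Dk DS DC Es Ek ES EC.
    generalize (sqrt (1 + (m * t) ^ 2)) (sqrt (1 - t ^ 2)) (sh n (m * t)) (ch n (m * t))
      (cn n t) (sn n t).
    intros e c s k C S HD He2 He He1 Hc Hc1 Hc2 RS Rk.
    replace (1 + (m * t) ^ 2) with (e * e) by lra.
    field_simplify_eq.
    2: { repeat split; nra. }
    replace (e * e) with (e ^ 2) in He2 by ring.
    replace (c * c) with (c ^ 2) in Hc2 by ring.
    replace (S * S) with (S ^ 2) in RS by ring.
    replace (k * k) with (k ^ 2) in Rk by ring.
    ring [He2 Hc2 RS Rk].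
Qed.

Lemma continuity_2d_pt_comp_derive (g : R -> R -> R) (h : R -> R) (x y : R) :
  ex_derive h (g x y) -> continuity_2d_pt g x y -> continuity_2d_pt (fun u v => h (g u v)) x y.
Proof.
  intros Hh Hg. apply continuity_1d_2d_pt_comp; [|exact Hg].
  apply continuity_pt_filterlim. exact (ex_derive_continuous h _ Hh).
Qed.

(** The pattern [?h ?n _] is meant for [sn n], [cn n], [sh n] and [ch n]; it comes after the
    arithmetic patterns because it could also match a binary operation with constant first argument.
    The last pattern catches [fun u v => u * v] in eta-reduced form, as unification produces it. *)
Ltac continuity_2d :=
  unfold integrand, conj_integrand, ratio, mixed, den, Rdiv; cbn [pow];
  repeat match goal with
  | |- continuity_2d_pt (fun _ _ => ?c) _ _ => apply continuity_2d_pt_const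
  | |- continuity_2d_pt (fun u _ => u) _ _ => apply continuity_2d_pt_id1
  | |- continuity_2d_pt (fun _ v => v) _ _ => apply continuity_2d_pt_id2
  | |- continuity_2d_pt (fun u v => _ + _) _ _ => apply continuity_2d_pt_plus
  | |- continuity_2d_pt (fun u v => _ - _) _ _ => apply continuity_2d_pt_minus
  | |- continuity_2d_pt (fun u v => _ * _) _ _ => apply continuity_2d_pt_mult
  | |- continuity_2d_pt (fun u v => - _) _ _ => apply continuity_2d_pt_opp
  | |- continuity_2d_pt (fun u v => / _) _ _ => apply continuity_2d_pt_inv
  | |- continuity_2d_pt (fun u v => sqrt _) _ _ =>
      apply (continuity_1d_2d_pt_comp sqrt); [apply continuity_pt_sqrt|]
  | |- continuity_2d_pt (fun u v => ?h ?n _) _ _ =>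
      apply (continuity_2d_pt_comp_derive _ (h n))
  | |- continuity_2d_pt Rmult _ _ =>
      apply (continuity_2d_pt_mult (fun u _ => u) (fun _ v => v))
  end.

Lemma continuity_2d_integrands (n m t : R) : 1 <= n -> 0 < m -> 0 < t < 1 ->
  continuity_2d_pt (mixed n) m t /\ continuity_2d_pt (integrand n) m t /\
  continuity_2d_pt (conj_integrand n) m t.
Proof.
  intros Hn Hm Ht. 
  pose proof (den_pos n m t Hn Hm (proj1 Ht)) as HD. unfold den in HD.
  assert (Hc1 : 0 < 1 - t * (t * 1)) by nra.
  assert (Hc : 0 < sqrt (1 - t * (t * 1))) by (now apply sqrt_lt_R0).
  assert (He1 : 0 < 1 + m * t * (m * t * 1)) by nra.
  assert (He : 0 < sqrt (1 + m * t * (m * t * 1))) by (now apply sqrt_lt_R0).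
  assert (H1 : 0 < 1 + m * (m * 1)) by nra.
  assert (Ht' : -1 < t < 1) by lra.
  assert (D1 := is_derive_sn n t Ht').
  assert (D2 := is_derive_cn n t Ht').
  assert (D3 := is_derive_sh n (m * t)).
  assert (D4 := is_derive_ch n (m * t)).
  repeat split; continuity_2d.
  all: try (eexists; eassumption).
  all: try lra.
  all: repeat apply Rmult_integral_contrapositive_currified; lra.
Qed.

(** * Bounds for large [m] and near the endpoints [t = 0] and [t = 1] *)

Lemma Rabs_sin_INR_mult (N : nat) (x : R) : Rabs (sin (INR N * x)) <= INR N * Rabs (sin x).
Proof.
  induction N as [|N IH].
  - cbn. rewrite !Rmult_0_l, sin_0, Rabs_R0. lra.
  - rewrite S_INR, Rmult_plus_distr_r, Rmult_1_l, sin_plus.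
    eapply Rle_trans; [apply Rabs_triang|]. rewrite !Rabs_mult.
    assert (Rabs (cos x) <= 1) by (apply Rabs_le; apply COS_bound).
    assert (Rabs (cos (INR N * x)) <= 1) by (apply Rabs_le; apply COS_bound).
    pose proof (Rabs_pos (sin x)). pose proof (Rabs_pos (sin (INR N * x))). nra.
Qed.

(** The induction advances by two, expanding [cos (2 x + y x)] with [sin (2 x) = 2 sin x cos x], so
    each step adds at most [2 |cos x|]. Oddness is essential: an even multiple has cosine 1 or -1
    where [cos x = 0]. *)
Lemma Rabs_cos_odd_mult (k : nat) (x : R) :
  Rabs (cos (INR (2 * k + 1) * x)) <= INR (2 * k + 1) * Rabs (cos x).
Proof.
  induction k as [|k IH].
  - cbn. rewrite !Rmult_1_l. lra.
  - replace (2 * S k + 1)%nat with (2 + (2 * k + 1))%nat by lia.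
    rewrite plus_INR. change (INR 2) with 2. set (y := INR (2 * k + 1)) in *.
    rewrite Rmult_plus_distr_r, cos_plus, sin_2a.
    unfold Rminus. eapply Rle_trans; [apply Rabs_triang|]. rewrite Rabs_Ropp, !Rabs_mult.
    assert (Rabs (cos (2 * x)) <= 1) by (apply Rabs_le; apply COS_bound).
    assert (Rabs (sin x) <= 1) by (apply Rabs_le; apply SIN_bound).
    assert (Rabs (sin (y * x)) <= 1) by (apply Rabs_le; apply SIN_bound).
    rewrite (Rabs_right 2) by lra.
    pose proof (Rabs_pos (cos x)). pose proof (Rabs_pos (sin x)).
    pose proof (Rabs_pos (cos (y * x))). pose proof (Rabs_pos (sin (y * x))).
    assert (Rabs (sin x) * Rabs (cos x) * Rabs (sin (y * x)) <= Rabs (cos x)).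
    { rewrite <- (Rmult_1_r (Rabs (cos x))) at 2.
      assert (Rabs (sin x) * Rabs (cos x) <= Rabs (cos x)) by nra.
      apply Rmult_le_compat; nra. }
    nra.
Qed.

Lemma Rabs_sn_le (N : nat) (t : R) : 0 <= t <= 1 -> Rabs (sn (INR N) t) <= INR N * t.
Proof.
  intros Ht. unfold sn. rewrite <- (Rabs_right t) at 2 by lra.
  rewrite <- (sin_asin t) at 2 by lra. apply Rabs_sin_INR_mult.
Qed.

Lemma Rabs_cn_le (k : nat) (t : R) : 0 <= t <= 1 ->
  Rabs (cn (INR (2 * k + 1)) t) <= INR (2 * k + 1) * sqrt (1 - t ^ 2).
Proof.
  intros Ht. unfold cn.
  replace (sqrt (1 - t ^ 2)) with (Rabs (cos (asin t))); [apply Rabs_cos_odd_mult|].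
  rewrite cos_asin by lra. rewrite Rabs_right by (apply Rle_ge, sqrt_pos).
  f_equal. unfold Rsqr. ring.
Qed.

Lemma le_sqrt_1_sqr (w : R) : w <= sqrt (1 + w ^ 2).
Proof.
  destruct (Rle_or_lt w 0) as [H|H].
  - apply (Rle_trans _ 0); [exact H|apply sqrt_pos].
  - rewrite <- (sqrt_square w) at 1 by lra. apply sqrt_le_1_alt. nra.
Qed.

Lemma sqrt_1_sqr_ge_1 (w : R) : 1 <= sqrt (1 + w ^ 2).
Proof. rewrite <- sqrt_1 at 1. apply sqrt_le_1_alt. nra. Qed.

Lemma sqrt_1_minus_sqr_bounds (t : R) : 0 < t < 1 -> 0 < sqrt (1 - t ^ 2) <= 1.
Proof.
  intros Ht. split; [apply sqrt_lt_R0; nra|].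
  rewrite <- sqrt_1 at 2. apply sqrt_le_1_alt. nra.
Qed.

(** From [|sn| <= N t], [den >= sh ^ 2] and [sh >= m t]. For [t] in a compact part of the open
    interval the bound is of order [1 / m], so the integral vanishes as [m] grows. *)
Lemma Rabs_integrand_le (N : nat) (m t : R) : 1 <= INR N -> 0 < m -> 0 < t < 1 ->
  Rabs (integrand (INR N) m t) <= INR N / (2 * m * t * sqrt (1 - t ^ 2)).
Proof.
  intros HN Hm Ht.
  pose proof (den_pos (INR N) m t HN Hm (proj1 Ht)) as HD.
  pose proof (sqrt_1_minus_sqr_bounds t Ht) as [Hc _].
  pose proof (sqrt_1_sqr_ge_1 (m * t)) as He.
  assert (Hw : 0 < m * t) by nra.
  pose proof (sh_ge_id (INR N) (m * t) HN (Rlt_le _ _ Hw)) as Hh.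
  pose proof (Rabs_sn_le N t ltac:(lra)) as HS.
  unfold integrand, den in *. revert HD Hc He Hh HS.
  generalize (sqrt (1 + (m * t) ^ 2)) (sqrt (1 - t ^ 2)) (sh (INR N) (m * t))
      (cn (INR N) t) (sn (INR N) t).
  intros e c h C S HD Hc He Hh HS.
  assert (HE : 0 < 2 * (C * C + h * h) * t * c * e) by (repeat apply Rmult_lt_0_compat; lra).
  rewrite Rabs_div, (Rabs_right (2 * _ * _ * _ * _)) by lra.
  rewrite Rabs_mult, (Rabs_right h) by lra.
  apply Rle_div_l; [lra|].
  replace (INR N / (2 * m * t * c) * (2 * (C * C + h * h) * t * c * e))
    with (INR N * (C * C + h * h) * e / m) by (field; lra).
  apply (Rle_div_r _ _ m); [lra|].
  apply (Rle_trans _ (INR N * (h * h))); [|].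
  - apply (Rle_trans _ (INR N * t * h * m)).
    + apply Rmult_le_compat_r; [lra|]. apply Rmult_le_compat_r; lra.
    + replace (INR N * t * h * m) with (INR N * (h * (m * t))) by ring.
      apply Rmult_le_compat_l; [lra|]. apply Rmult_le_compat_l; lra.
  - rewrite Rmult_assoc. apply Rmult_le_compat_l; [lra|]. nra.
Qed.

Lemma cosh_ge_1 (x : R) : 1 <= cosh x.
Proof.
  assert (0 < cosh x).
  { unfold cosh. pose proof (exp_pos x). pose proof (exp_pos (- x)). lra. }
  pose proof (cosh2_sinh2 x). nra.
Qed.

(** The linear bound serves when [sh] may be large; the quadratic one shows that [ch] is within
    [sh ^ 2] of 1 when [sh] is small. *)
Lemma ch_bounds (n w : R) : 0 <= sh n w -> 1 <= ch n w <= 1 + sh n w /\ ch n w <= 1 + sh n w ^ 2.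
Proof.
  intros H. pose proof (cosh_ge_1 (n * arcsinh w)) as H1. fold (ch n w) in H1.
  pose proof (ch2_sh2 n w). repeat split; nra.
Qed.

Lemma INR_odd_ge_1 (k : nat) : 1 <= INR (2 * k + 1).
Proof. rewrite plus_INR. pose proof (pos_INR (2 * k)). cbn [INR]. lra. Qed.

(** Both summands of the numerator carry a factor [sqrt (1 - t ^ 2)]: the first through the bound on
    [cn] for odd multiples, the second explicitly. The estimate is uniform in [m >= 2 p], as needed
    to integrate over [m]. *)
Lemma ratio_le_at_1 (k : nat) (p m t : R) : 0 < p -> 2 * p <= m -> 1 / 2 <= t < 1 ->
  Rabs (ratio (INR (2 * k + 1)) m t) <=
  (INR (2 * k + 1) / p ^ 2 + (INR (2 * k + 1) + 2) / p) * sqrt (1 - t ^ 2).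
Proof.
  intros Hp Hm Ht.
  pose proof (INR_odd_ge_1 k) as HN.
  pose proof (Rabs_cn_le k t ltac:(lra)) as HC.
  revert HN HC. set (n := INR (2 * k + 1)). intros HN HC.
  pose proof (den_pos n m t HN ltac:(lra) ltac:(lra)) as HD.
  pose proof (sqrt_1_minus_sqr_bounds t ltac:(lra)) as [Hc Hc1].
  pose proof (sqrt_1_sqr_ge_1 (m * t)) as He.
  pose proof (le_sqrt_1_sqr (m * t)) as Hew.
  assert (Hw : p <= m * t) by nra.
  pose proof (sh_ge_id n (m * t) HN ltac:(lra)) as Hh.
  pose proof (ch_bounds n (m * t) ltac:(lra)) as [[Hk Hk1] _].
  assert (HS : Rabs (sn n t) <= 1) by (apply Rabs_le; apply SIN_bound).
  unfold ratio, den in *. revert HC HD Hc Hc1 He Hew Hh HS Hk Hk1.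
  generalize (sqrt (1 + (m * t) ^ 2)) (sqrt (1 - t ^ 2)) (sh n (m * t)) (ch n (m * t))
      (cn n t) (sn n t).
  intros e c h q C S HC HD Hc Hc1 He Hew Hh HS Hk Hk1.
  rewrite Rabs_div, (Rabs_right (C * C + h * h)) by lra.
  apply Rle_div_l; [lra|].
  (* The factor 2 bounds [m / e], since [e >= m t >= m / 2]. *)
  apply (Rle_trans _ (n * c * (1 + h) + 2 * c * h)).
  - eapply Rle_trans; [apply Rabs_triang|]. apply Rplus_le_compat.
    + rewrite Rabs_mult, (Rabs_right q) by lra.
      apply Rmult_le_compat; try lra. apply Rabs_pos.
    + rewrite Rabs_div, !Rabs_mult, (Rabs_right e), (Rabs_right m), (Rabs_right c), (Rabs_right h)
        by lra.
      apply Rle_div_l; [lra|].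
      apply (Rle_trans _ (m * c * 1 * h)).
      * apply Rmult_le_compat_r; [lra|]. apply Rmult_le_compat_l; [nra|exact HS].
      * replace (m * c * 1 * h) with (c * h * m) by ring.
        replace (2 * c * h * e) with (c * h * (2 * e)) by ring.
        apply Rmult_le_compat_l; nra.
  (* Since [h >= p], both 1 and [h] are dominated by multiples of [h * h], hence of the
     denominator. *)
  - assert (A1 : 1 <= h * h / p ^ 2) by (apply (Rle_div_r 1 _ (p ^ 2)); nra).
    assert (A2 : h <= h * h / p) by (apply (Rle_div_r h _ p); nra).
    apply (Rle_trans _ (c * (n * (h * h / p ^ 2) + (n + 2) * (h * h / p)))).
    + replace (n * c * (1 + h) + 2 * c * h) with (c * (n * 1 + (n + 2) * h)) by ring.
      apply Rmult_le_compat_l; [lra|].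
      apply Rplus_le_compat; apply Rmult_le_compat_l; lra.
    + replace (c * (n * (h * h / p ^ 2) + (n + 2) * (h * h / p)))
        with ((n / p ^ 2 + (n + 2) / p) * c * (h * h)) by (field; lra).
      apply Rmult_le_compat_l; [|nra].
      apply Rmult_le_pos; [|lra].
      assert (0 <= n / p ^ 2) by (apply Rdiv_le_0_compat; nra).
      assert (0 <= (n + 2) / p) by (apply Rdiv_le_0_compat; nra). lra.
Qed.

(** A crude bound valid for every [m], for the range where [m t] need not be small. The factor [m]
    in the numerator is absorbed by [m t <= sqrt (1 + (m t) ^ 2)]. *)
Lemma ratio_le_at_0 (N : nat) (m t : R) : 1 <= INR N -> 0 < m -> 0 < t < 1 ->
  1 / 2 <= cn (INR N) t ->
  Rabs (ratio (INR N) m t - 1) <= INR N + 6.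
Proof.
  intros HN Hm Ht HC.
  pose proof (den_pos (INR N) m t HN Hm (proj1 Ht)) as HD.
  pose proof (sqrt_1_minus_sqr_bounds t Ht) as [Hc Hc1].
  pose proof (sqrt_1_sqr_ge_1 (m * t)) as He.
  pose proof (le_sqrt_1_sqr (m * t)) as Hew.
  assert (Hw : 0 < m * t) by nra.
  pose proof (sh_ge_id (INR N) (m * t) HN (Rlt_le _ _ Hw)) as Hh.
  pose proof (ch_bounds (INR N) (m * t) ltac:(lra)) as [[Hk Hk1] _].
  pose proof (Rabs_sn_le N t ltac:(lra)) as HS.
  assert (HC1 : cn (INR N) t <= 1) by apply COS_bound.
  apply (Rle_trans _ (Rabs (ratio (INR N) m t) + 1)).
  { eapply Rle_trans; [apply Rabs_triang|]. rewrite Rabs_Ropp, Rabs_R1. lra. }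
  cut (Rabs (ratio (INR N) m t) <= INR N + 5); [lra|].
  unfold ratio, den in *. revert HC HC1 HD Hc Hc1 He Hew Hh HS Hk Hk1.
  generalize (sqrt (1 + (m * t) ^ 2)) (sqrt (1 - t ^ 2)) (sh (INR N) (m * t))
     (ch (INR N) (m * t)) (cn (INR N) t) (sn (INR N) t).
  intros e c h q C S HC HC1 HD Hc Hc1 He Hew Hh HS Hk Hk1.
  rewrite Rabs_div, (Rabs_right (C * C + h * h)) by lra.
  apply Rle_div_l; [lra|].
  apply (Rle_trans _ (1 + h + INR N * h)).
  - eapply Rle_trans; [apply Rabs_triang|]. apply Rplus_le_compat.
    + rewrite Rabs_right; nra.
    + rewrite Rabs_div, !Rabs_mult, (Rabs_right e), (Rabs_right m), (Rabs_right c), (Rabs_right h)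
        by lra.
      apply Rle_div_l; [lra|].
      replace (INR N * h * e) with (INR N * e * h) by ring.
      apply Rmult_le_compat_r; [lra|].
      apply (Rle_trans _ (m * 1 * (INR N * t))).
      * apply Rmult_le_compat; try nra. apply Rabs_pos.
      * replace (m * 1 * (INR N * t)) with (INR N * (m * t)) by ring.
        apply Rmult_le_compat_l; lra.
  (* With denominator [D = C * C + h * h], [1 <= 4 D] and [h <= D], which gives the constant
     [N + 5]. *)
  - assert (1 / 4 <= C * C) by nra.
    assert (h <= C * C + h * h) by (pose proof (pow2_ge_0 (h - 1 / 2)); nra).
    nra.
Qed.

(** Numerator minus denominator is [C (q - C) - h ^ 2] plus the mixed term, all of order [d]; the
    denominator is at least [1 / 4], whence the factor 4. Monotonicity of [sh] lets the single
    condition at [M] cover all [m <= M]. *)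
Lemma ratio_near_1 (N : nat) (M d m t : R) : 1 <= INR N -> 0 < m <= M -> 0 < t < 1 -> d <= 1 ->
  1 / 2 <= cn (INR N) t -> INR N * t <= d -> sh (INR N) (M * t) <= d ->
  Rabs (ratio (INR N) m t - 1) <= 4 * (3 + M) * d.
Proof.
  intros HN Hm Ht Hd HC HNt HMt.
  pose proof (den_pos (INR N) m t HN ltac:(lra) (proj1 Ht)) as HD.
  pose proof (sqrt_1_minus_sqr_bounds t Ht) as [Hc Hc1].
  pose proof (sqrt_1_sqr_ge_1 (m * t)) as He.
  assert (Hw : 0 < m * t) by nra.
  assert (Hhd : sh (INR N) (m * t) <= d).
  { apply (Rle_trans _ (sh (INR N) (M * t))); [|exact HMt]. unfold sh.
    assert (A : arcsinh (m * t) <= arcsinh (M * t)) by (apply arcsinh_le; nra).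
    destruct (Rle_lt_or_eq_dec _ _ A) as [L|E].
    - left. apply sinh_lt. nra.
    - rewrite E. lra. }
  pose proof (sh_ge_id (INR N) (m * t) HN (Rlt_le _ _ Hw)) as Hh.
  pose proof (ch_bounds (INR N) (m * t) ltac:(lra)) as [[Hk _] Hk2].
  pose proof (Rabs_sn_le N t ltac:(lra)) as HS.
  assert (HC1 : cn (INR N) t <= 1) by apply COS_bound.
  pose proof (sn2_cn2 (INR N) t) as R1.
  unfold ratio, den in *. revert HC HC1 HD Hc Hc1 He Hh HS Hk Hk2 Hhd R1.
  generalize (sqrt (1 + (m * t) ^ 2)) (sqrt (1 - t ^ 2)) (sh (INR N) (m * t))
     (ch (INR N) (m * t)) (cn (INR N) t) (sn (INR N) t).
  intros e c h q C S HC HC1 HD Hc Hc1 He Hh HS Hk Hk2 Hhd R1.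
  assert (HSd : Rabs S <= d) by lra.
  assert (HS2 : S * S <= d).
  { rewrite <- (Rabs_right (S * S)) by nra. rewrite Rabs_mult. pose proof (Rabs_pos S). nra. }
  replace ((C * q + m * c * S * h / e) / (C * C + h * h) - 1)
    with ((C * (q - C) - h * h + m * c * S * h / e) / (C * C + h * h)) by (field; lra).
  rewrite Rabs_div, (Rabs_right (C * C + h * h)) by lra.
  apply Rle_div_l; [lra|].
  apply (Rle_trans _ ((3 + M) * d)).
  - eapply Rle_trans; [apply Rabs_triang|].
    replace ((3 + M) * d) with (3 * d + M * d) by ring.
    apply Rplus_le_compat.
    (* Here [q - 1 <= h * h] and [1 - C <= 1 - C * C = S * S], so three errors of size [d] add
       up. *)
    + assert (h * h <= d) by nra. apply Rabs_le; split; nra.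
    + rewrite Rabs_div, !Rabs_mult, (Rabs_right e), (Rabs_right m), (Rabs_right c), (Rabs_right h)
        by lra.
      apply Rle_div_l; [lra|].
      pose proof (Rabs_pos S).
      apply (Rle_trans _ (M * 1 * d * 1)).
      * repeat apply Rmult_le_compat; try lra; repeat apply Rmult_le_pos; lra.
      * assert (0 <= M * d) by nra. nra.
  - assert (0 <= (3 + M) * d) by nra.
    assert (1 / 4 <= C * C + h * h) by nra. nra.
Qed.

(** * Integration in [m] against the arctangent density *)

Lemma is_RInt_atan_density (K a b : R) :
  is_RInt (fun m => K / (2 * (1 + m ^ 2))) a b (K / 2 * (atan b - atan a)).
Proof.
  apply (is_RInt_ext (fun m => scal (K / 2) (/ (1 + m²)))).
  - intros m _. change (K / 2 * / (1 + m²) = K / (2 * (1 + m ^ 2))). unfold Rsqr. field. nra.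
  - apply (is_RInt_scal (V := R_NormedModule)).
    apply (is_RInt_derive (V := R_CompleteNormedModule) atan); intros m _.
    + apply is_derive_atan.
    + apply (ex_derive_continuous (fun m => / (1 + m²))). auto_derive. unfold Rsqr. nra.
Qed.

(** Keeping the [atan] primitive makes the bound stay finite however far [b] is moved to the
    right. *)
Lemma RInt_atan_density_le (r : R -> R) (K a b v : R) : a <= b ->
  (forall m, a <= m <= b -> Rabs (r m) <= K) ->
  is_RInt (fun m => r m / (2 * (1 + m ^ 2))) a b v ->
  Rabs v <= K / 2 * (atan b - atan a).
Proof.
  intros Hab Hr Hv.
  apply (norm_RInt_le (V := R_NormedModule) (fun m => r m / (2 * (1 + m ^ 2)))
           (fun m => K / (2 * (1 + m ^ 2))) a b); [exact Hab| |exact Hv|apply is_RInt_atan_density].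
  intros m Hm. change (norm (r m / (2 * (1 + m ^ 2)))) with (Rabs (r m / (2 * (1 + m ^ 2)))).
  assert (0 < 1 + m ^ 2) by nra.
  rewrite Rabs_div, (Rabs_right (2 * _)) by lra.
  apply Rmult_le_compat_r; [left; apply Rinv_0_lt_compat; lra|auto].
Qed.

Lemma atan_le_id (x : R) : 0 <= x -> atan x <= x.
Proof.
  intros Hx.
  destruct (MVT_gen atan 0 x (fun m => / (1 + m²))) as [c [_ E]].
  - intros; apply is_derive_atan.
  - intros; apply derivable_continuous_pt, derivable_pt_atan.
  - rewrite atan_0 in E. assert (/ (1 + c²) <= 1).
    { rewrite <- Rinv_1 at 2. apply Rinv_le_contravar; [lra|]. unfold Rsqr; nra. }
    nra.
Qed.

Lemma pi2_minus_atan_le (x : R) : 0 < x -> PI / 2 - atan x <= / x.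
Proof.
  intros Hx. rewrite <- atan_inv by exact Hx. apply atan_le_id.
  left. now apply Rinv_0_lt_compat.
Qed.

(** * The improper integral for positive [m] *)

Lemma ex_RInt_integrand (n m x y : R) : 1 <= n -> 0 < m -> 0 < x <= y -> y < 1 ->
  ex_RInt (integrand n m) x y.
Proof.
  intros Hn Hm Hxy Hy. apply (ex_RInt_continuous (V := R_CompleteNormedModule)).
  intros t Ht. rewrite Rmin_left, Rmax_right in Ht by lra.
  apply continuity_2d_section, continuity_2d_integrands; lra.
Qed.

Lemma continuous_conj_integrand (n m t : R) : 1 <= n -> 0 < m -> 0 < t < 1 ->
  continuous (fun u => conj_integrand n u t) m.
Proof.
  intros Hn Hm Ht. apply continuity_pt_filterlim.
  destruct (continuity_2d_integrands n m t Hn Hm Ht) as (_ & _ & H).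
  intros eps Heps. destruct (H (mkposreal eps Heps)) as [d Hd].
  exists d; split; [apply cond_pos|].
  intros u [_ Hu]; apply Hd; [exact Hu|].
  rewrite Rminus_diag, Rabs_R0; apply cond_pos.
Qed.

Lemma is_RInt_conj_integrand (n l L x y : R) : 1 <= n -> 0 < l <= L -> 0 < x <= y -> y < 1 ->
  is_RInt (fun m => conj_integrand n m y - conj_integrand n m x) l L
    (RInt (integrand n L) x y - RInt (integrand n l) x y).
Proof.
  intros Hn HlL Hxy Hy.
  apply (closed_form_RInt (integrand n) (conj_integrand n) (mixed n)
           (fun m => 0 < m) (fun t => 0 < t /\ t < 1)).
  - apply open_gt.
  - apply open_and; [apply open_gt|apply open_lt].
  - intros; now apply is_derive_integrand.
  - intros; now apply is_derive_conj_integrand.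
  - intros; now apply continuity_2d_integrands.
  - intros; now apply continuity_2d_section, continuity_2d_integrands.
  - intros; now apply continuous_conj_integrand.
  - lra.
  - intros m. rewrite Rmin_left by lra. lra.
  - intros t Ht; lra.
Qed.

(** The three errors come from the side [t = x] with [m <= M], where [ratio] is near 1, from the
    side [t = y], and from the side [t = x] beyond [M], where [ratio] is merely bounded but little
    arctangent mass is left. *)
Lemma RInt_integrand_approx (k : nat) (l M d x y : R) :
  let n := INR (2 * k + 1) in
  0 < l <= M -> 0 < x <= y -> 1 / 2 <= y < 1 ->
  1 / 2 <= cn n x -> n * x <= d -> d <= 1 -> sh n (M * x) <= d ->
  Rabs (RInt (integrand n l) x y - (PI / 2 - atan l) / 2) <=
  PI / 4 * (4 * (3 + M) * d)
  + PI / 4 * ((n / (l / 2) ^ 2 + (n + 2) / (l / 2)) * sqrt (1 - y ^ 2))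
  + (n + 7) / 2 * (PI / 2 - atan M).
Proof.
  intros n Hl Hx Hy HC Hnx Hd HM.
  assert (Hn : 1 <= n) by apply INR_odd_ge_1.
  pose proof (sqrt_1_minus_sqr_bounds y ltac:(lra)) as [Hcy _].
  set (K := (n / (l / 2) ^ 2 + (n + 2) / (l / 2)) * sqrt (1 - y ^ 2)).
  apply le_epsilon. intros eta Heta.
  (* The far side [m = L] of the rectangle is chosen so that [Rabs_integrand_le] makes its
     contribution at most [eta]. *)
  set (L := M + n / (2 * x * sqrt (1 - y ^ 2)) / eta).
  assert (HQ : 0 < n / (2 * x * sqrt (1 - y ^ 2))).
  { apply Rdiv_lt_0_compat; [lra|]. repeat apply Rmult_lt_0_compat; lra. }
  assert (HQe : 0 < n / (2 * x * sqrt (1 - y ^ 2)) / eta) by now apply Rdiv_lt_0_compat.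
  assert (HML : M < L) by (unfold L; lra).
  assert (HfL : Rabs (RInt (integrand n L) x y) <= eta).
  { apply (Rle_trans _ ((y - x) * eta)); [|nra].
    apply abs_RInt_le_const; [lra|apply ex_RInt_integrand; lra|].
    intros t Ht. eapply Rle_trans; [apply (Rabs_integrand_le (2 * k + 1)); fold n; lra|]. fold n.
    assert (Hct : sqrt (1 - y ^ 2) <= sqrt (1 - t ^ 2)) by (apply sqrt_le_1_alt; nra).
    apply (Rle_trans _ (n / (2 * L * x * sqrt (1 - y ^ 2)))).
    - apply Rmult_le_compat_l; [lra|]. apply Rinv_le_contravar.
      + repeat apply Rmult_lt_0_compat; lra.
      + apply Rmult_le_compat; try lra; [repeat apply Rmult_le_pos; lra|].
        apply Rmult_le_compat_l; lra.
    - replace (n / (2 * L * x * sqrt (1 - y ^ 2)))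
        with (n / (2 * x * sqrt (1 - y ^ 2)) / L) by (field; lra).
      apply Rle_div_l; [lra|].
      replace (eta * L) with (eta * M + n / (2 * x * sqrt (1 - y ^ 2)))
        by (unfold L; field; lra).
      nra. }
  assert (Cg : forall z a b, 0 < z < 1 -> 0 < a <= b ->
             ex_RInt (fun m => conj_integrand n m z) a b).
  { intros z a b Hz Hab. apply (ex_RInt_continuous (V := R_CompleteNormedModule)).
    intros m Hm. rewrite Rmin_left in Hm by lra. apply continuous_conj_integrand; lra. }
  assert (Bx : forall a b B, 0 < a <= b ->
      (forall m, a <= m <= b -> Rabs (ratio n m x - 1) <= B) ->
      Rabs (RInt (fun m => conj_integrand n m x) a b - 1 / 2 * (atan b - atan a))
      <= B / 2 * (atan b - atan a)).
  { intros a b B Hab HB.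
    apply (RInt_atan_density_le (fun m => ratio n m x - 1)); [lra|exact HB|].
    apply (is_RInt_ext (fun m => minus (conj_integrand n m x) (1 / (2 * (1 + m ^ 2))))).
    - intros m _. unfold conj_integrand, minus, plus, opp; cbn -[pow]. field. nra.
    - apply (is_RInt_minus (V := R_NormedModule)); [|apply is_RInt_atan_density].
      apply (RInt_correct (V := R_CompleteNormedModule)), Cg; lra. }
  assert (E0 : RInt (integrand n l) x y
             = RInt (integrand n L) x y + RInt (fun m => conj_integrand n m x) l M
               + RInt (fun m => conj_integrand n m x) M L
               - RInt (fun m => conj_integrand n m y) l L).
  { pose proof (is_RInt_conj_integrand n l L x y Hn ltac:(lra) Hx ltac:(lra)) as H.
    apply (is_RInt_unique (V := R_CompleteNormedModule)) in H.
    assert (E : RInt (fun m => conj_integrand n m y - conj_integrand n m x) l L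
              = RInt (fun m => conj_integrand n m y) l L - RInt (fun m => conj_integrand n m x) l L)
      by (apply (RInt_minus (V := R_CompleteNormedModule)); apply Cg; lra).
    assert (E' : RInt (fun m => conj_integrand n m x) l M + RInt (fun m => conj_integrand n m x) M L
               = RInt (fun m => conj_integrand n m x) l L)
      by (apply (RInt_Chasles (V := R_CompleteNormedModule)); apply Cg; lra).
    lra. }
  assert (B1 := Bx l M (4 * (3 + M) * d) ltac:(lra)
    ltac:(intros m Hm; apply (ratio_near_1 (2 * k + 1)); fold n; lra)).
  assert (B2 := Bx M L (n + 6) ltac:(lra)
    ltac:(intros m Hm; apply (ratio_le_at_0 (2 * k + 1)); fold n; lra)).
  assert (B3 : Rabs (RInt (fun m => conj_integrand n m y) l L) <= K / 2 * (atan L - atan l)).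
  { apply (RInt_atan_density_le (fun m => ratio n m y)); [lra| |].
    - intros m Hm. apply ratio_le_at_1; lra.
    - apply (RInt_correct (V := R_CompleteNormedModule)), Cg; lra. }
  assert (Al : 0 < atan l) by (rewrite <- atan_0; apply atan_increasing; lra).
  assert (AM : atan M < atan L) by now apply atan_increasing.
  pose proof (atan_bound L) as [_ AL].
  assert (HK : 0 <= K).
  { unfold K. apply Rmult_le_pos; [|lra].
    assert (0 <= n / (l / 2) ^ 2) by (apply Rdiv_le_0_compat; nra).
    assert (0 <= (n + 2) / (l / 2)) by (apply Rdiv_le_0_compat; nra). lra. }
  assert (Hd0 : 0 <= 4 * (3 + M) * d).
  { assert (0 <= n * x) by (apply Rmult_le_pos; lra). apply Rmult_le_pos; lra. }
  assert (C1 : 4 * (3 + M) * d / 2 * (atan M - atan l) <= PI / 4 * (4 * (3 + M) * d)).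
  { replace (PI / 4 * (4 * (3 + M) * d)) with (4 * (3 + M) * d / 2 * (PI / 2)) by field.
    apply Rmult_le_compat_l; lra. }
  assert (C2 : (n + 6) / 2 * (atan L - atan M) <= (n + 6) / 2 * (PI / 2 - atan M))
    by (apply Rmult_le_compat_l; lra).
  assert (C3 : K / 2 * (atan L - atan l) <= PI / 4 * K).
  { replace (PI / 4 * K) with (K / 2 * (PI / 2)) by field. apply Rmult_le_compat_l; lra. }
  (* The main terms add up to [(atan L - atan l) / 2]; replacing [atan L] by [PI / 2] costs at most
     [(PI / 2 - atan M) / 2], which raises [n + 6] to [n + 7]. *)
  rewrite E0. apply Rabs_le_between in HfL, B1, B2, B3. apply Rabs_le_between. lra.
Qed.

Lemma continuous_eventually_lt (h : R -> R) (z c : R) :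
  continuous h z -> h z < c -> locally z (fun t => h t < c).
Proof. intros Hh Hz. apply (Hh (fun u => u < c)). now apply (open_lt c). Qed.

Lemma is_RInt_gen_integrand (k : nat) (l : R) : 0 < l ->
  is_RInt_gen (integrand (INR (2 * k + 1)) l) (at_right 0) (at_left 1) ((PI / 2 - atan l) / 2).
Proof.
  intros Hl. set (n := INR (2 * k + 1)).
  assert (Hn : 1 <= n) by apply INR_odd_ge_1.
  intros P [eps HP]. pose proof (cond_pos eps) as Heps. pose proof PI_RGT_0 as Hpi.
  (* The order of choice matters: [M] depends on [eps], then [d] on [M], and only then is [x] taken
     near 0 and [y] near 1. Each of the three errors is at most [eps / 4]. *)
  set (M := l + 2 * (n + 7) / eps).
  assert (HM1 : 0 < 2 * (n + 7) / eps) by (apply Rdiv_lt_0_compat; lra).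
  assert (HM : (n + 7) / 2 * (PI / 2 - atan M) <= eps / 4).
  { apply (Rle_trans _ ((n + 7) / 2 * / (2 * (n + 7) / eps))).
    - apply Rmult_le_compat_l; [lra|].
      eapply Rle_trans; [apply pi2_minus_atan_le; unfold M; lra|].
      apply Rinv_le_contravar; unfold M; lra.
    - right. field. lra. }
  set (d := Rmin 1 (eps / 4 / (PI * (3 + M)))).
  assert (HPM : 0 < PI * (3 + M)) by (apply Rmult_lt_0_compat; unfold M; lra).
  assert (Hd0 : 0 < d).
  { apply Rmin_glb_lt; [lra|]. apply Rdiv_lt_0_compat; lra. }
  assert (Hd : PI / 4 * (4 * (3 + M) * d) <= eps / 4).
  { replace (PI / 4 * (4 * (3 + M) * d)) with (d * (PI * (3 + M))) by field.
    apply Rle_div_r; [exact HPM|]. apply Rmin_r. }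
  set (K := n / (l / 2) ^ 2 + (n + 2) / (l / 2)).
  assert (HK : 0 < K).
  { assert (0 < n / (l / 2) ^ 2) by (apply Rdiv_lt_0_compat; nra).
    assert (0 < (n + 2) / (l / 2)) by (apply Rdiv_lt_0_compat; nra). unfold K; lra. }
  assert (HPK : 0 < PI / 4 * K) by (apply Rmult_lt_0_compat; lra).
  apply (Filter_prod _ _ _
    (fun x => 0 < x /\ x < 1 / 2 /\ 1 / 2 <= cn n x /\ n * x <= d /\ sh n (M * x) <= d)
    (fun y => 1 / 2 < y /\ y < 1 /\ sqrt (1 - y ^ 2) < eps / 4 / (PI / 4 * K))).
  - assert (C1 : locally 0 (fun x : R => x < 1 / 2)) by (apply open_lt; lra).
    assert (C2 : locally 0 (fun x : R => - cn n x < - (1 / 2))).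
    { apply continuous_eventually_lt.
      - apply (continuous_opp (V := R_NormedModule) (cn n)), ex_derive_continuous.
        eexists; apply is_derive_cn; lra.
      - unfold cn. rewrite asin_0, Rmult_0_r, cos_0. lra. }
    assert (C3 : locally 0 (fun x : R => n * x < d)).
    { apply continuous_eventually_lt; [|lra]. apply (ex_derive_continuous (fun x => n * x)).
      auto_derive; auto. }
    assert (C4 : locally 0 (fun x : R => sh n (M * x) < d)).
    { apply continuous_eventually_lt.
      - apply (continuous_comp (fun x => M * x) (sh n)).
        + apply (ex_derive_continuous (fun x => M * x)). auto_derive; auto.
        + apply (ex_derive_continuous (sh n)). eexists; apply is_derive_sh.
      - unfold sh. rewrite Rmult_0_r, arcsinh_0, Rmult_0_r, sinh_0. exact Hd0. }
    unfold at_right, within.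
    generalize (filter_and _ _ (filter_and _ _ C1 C2) (filter_and _ _ C3 C4)).
    apply filter_imp. intros x H Hx. lra.
  - assert (C1 : locally 1 (fun y : R => 1 / 2 < y)) by (apply open_gt; lra).
    assert (C2 : locally 1 (fun y : R => sqrt (1 - y ^ 2) < eps / 4 / (PI / 4 * K))).
    { apply continuous_eventually_lt.
      - apply (continuous_comp (fun y => 1 - y ^ 2) sqrt).
        + apply (ex_derive_continuous (fun y => 1 - y ^ 2)). auto_derive; auto.
        + apply continuous_sqrt.
      - replace (1 - 1 ^ 2) with 0 by ring. rewrite sqrt_0.
        apply Rdiv_lt_0_compat; lra. }
    unfold at_left, within. generalize (filter_and _ _ C1 C2).
    apply filter_imp. intros x H Hx. lra.
  - intros x y (Hx & Hx2 & HC & Hnx & Hs) (Hy & Hy1 & Hc).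
    exists (RInt (integrand n l) x y). split.
    + apply (RInt_correct (V := R_CompleteNormedModule)), ex_RInt_integrand; cbn [fst snd]; lra.
    + apply HP. apply (Rle_lt_trans _ (3 * (eps / 4))); [|lra].
      eapply Rle_trans.
      * apply (RInt_integrand_approx k l M d x y); fold n; try lra.
        -- unfold M; lra.
        -- apply Rmin_l.
      * fold n. fold K. apply Rlt_div_r in Hc; [|exact HPK]. lra.
Qed.

(** * Parity, double angles and the reduction to positive parameters *)

Lemma sinh_opp (x : R) : sinh (- x) = - sinh x.
Proof. unfold sinh. rewrite Ropp_involutive. field. Qed.

Lemma arcsinh_opp (x : R) : arcsinh (- x) = - arcsinh x.
Proof. rewrite <- (sinh_arcsinh x) at 1. rewrite <- sinh_opp. apply arcsinh_sinh. Qed.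

Lemma cosh_opp (x : R) : cosh (- x) = cosh x.
Proof. unfold cosh. rewrite Ropp_involutive. field. Qed.

Lemma cosh_2a (x : R) : cosh (2 * x) = 1 + 2 * (sinh x * sinh x).
Proof.
  pose proof (cosh2_sinh2 x) as H.
  replace (cosh (2 * x)) with (cosh x * cosh x + sinh x * sinh x); [lra|].
  unfold cosh, sinh. replace (2 * x) with (x + x) by ring. rewrite Ropp_plus_distr, !exp_plus. field.
Qed.

Theorem theorem1 (n : Z) (hn : Z.Odd n) (a : R) (ha : a <> 0) :
  is_RInt_gen
    (fun t : R =>
       sin (IZR n * asin t) * sinh (IZR n * arcsinh (t / a))
       / (cos (2 * IZR n * asin t) + cosh (2 * IZR n * arcsinh (t / a)))
       * (1 / (t * sqrt (1 - t ^ 2) * sqrt (1 + t ^ 2 / a ^ 2))))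
    (at_right 0) (at_left 1) (atan a / 2).
Proof.
  set (F := fun (z b t : R) =>
       sin (z * asin t) * sinh (z * arcsinh (t / b))
       / (cos (2 * z * asin t) + cosh (2 * z * arcsinh (t / b)))
       * (1 / (t * sqrt (1 - t ^ 2) * sqrt (1 + t ^ 2 / b ^ 2)))).
  change (is_RInt_gen (F (IZR n) a) (at_right 0) (at_left 1) (atan a / 2)).
  assert (main : forall (k : nat) (b : R), 0 < b ->
            is_RInt_gen (F (INR (2 * k + 1)) b) (at_right 0) (at_left 1) (atan b / 2)).
  { intros k b Hb. set (z := INR (2 * k + 1)).
    assert (Hz : 1 <= z) by apply INR_odd_ge_1.
    assert (Hb' : 0 < / b) by now apply Rinv_0_lt_compat.
    replace (atan b) with (PI / 2 - atan (/ b)) by (rewrite atan_inv by exact Hb; ring).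
    apply (is_RInt_gen_ext (integrand z (/ b))); [|now apply is_RInt_gen_integrand].
    (* Both endpoints are kept inside [(0, 1)], so that every [t] between them lies there and the
       denominators are nonzero. *)
    apply (Filter_prod _ _ _ (fun x => 0 < x /\ x < 1) (fun y => 0 < y /\ y < 1)).
    - unfold at_right, within.
      assert (C : locally 0 (fun x : R => x < 1)) by (apply open_lt; lra).
      revert C; apply filter_imp; intros x; lra.
    - unfold at_left, within.
      assert (C : locally 1 (fun x : R => 0 < x)) by (apply open_gt; lra).
      revert C; apply filter_imp; intros x; lra.
    - intros x y [Hx Hx1] [Hy Hy1] t Ht. cbn [fst snd] in Ht.
      assert (T : 0 < t < 1).
      { split; [apply (Rlt_trans _ (Rmin x y))|apply (Rlt_trans _ (Rmax x y))]; try lra.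
        - now apply Rmin_glb_lt.
        - now apply Rmax_lub_lt. }
      pose proof (den_pos z (/ b) t Hz Hb' (proj1 T)) as HD.
      pose proof (sqrt_1_minus_sqr_bounds t T) as [Hc _].
      pose proof (sqrt_1_sqr_ge_1 (t / b)) as He.
      unfold F, integrand, den in *.
      replace (t ^ 2 / b ^ 2) with ((t / b) ^ 2) by (field; lra).
      rewrite (Rmult_comm (/ b) t) in *. change (t * / b) with (t / b) in *.
      rewrite !(Rmult_assoc 2 z), cosh_2a, cos_2a_cos.
      unfold cn, sn, sh in *.
      (* The equality is stated in the carrier of a normed module; [field] needs it at type [R]. *)
      match goal with |- ?u = ?v => change (@eq R u v) end.
      field. repeat split; lra. }
  assert (pos : forall b, 0 < b -> is_RInt_gen (F (IZR n) b) (at_right 0) (at_left 1) (atan b / 2)).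
  { intros b Hb. destruct hn as [j Hj]. destruct (Z_le_gt_dec 0 j) as [Hj0|Hj0].
    - replace (IZR n) with (INR (2 * Z.to_nat j + 1)); [now apply main|].
      rewrite INR_IZR_INZ. f_equal. lia.
    (* The integrand is even in [n], as [sin] and [sinh] both change sign; for [n = 2 j + 1] with
       [j < 0], [- n = 2 (- j - 1) + 1]. *)
    - apply (is_RInt_gen_ext (F (- IZR n) b)).
      + apply filter_forall. intros _ t _. unfold F.
        rewrite !Ropp_mult_distr_r_reverse, !Ropp_mult_distr_l_reverse.
        rewrite sin_neg, cos_neg, sinh_opp, cosh_opp.
        rewrite Rmult_opp_opp. reflexivity.
      + replace (- IZR n) with (INR (2 * Z.to_nat (- j - 1) + 1)); [now apply main|].
        rewrite INR_IZR_INZ, <- opp_IZR. f_equal. lia. }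
  destruct (Rlt_or_le 0 a) as [Ha|Ha]; [now apply pos|].
  assert (Ha' : 0 < - a) by lra.
  replace (atan a / 2) with (opp (atan (- a) / 2))
    by (change (- (atan (- a) / 2) = atan a / 2); rewrite atan_opp; field).
  (* Both sides are odd in [a]: only the [sinh] factor changes sign. *)
  apply (is_RInt_gen_ext (fun t => opp (F (IZR n) (- a) t))).
  - apply filter_forall. intros _ t _. change (- F (IZR n) (- a) t = F (IZR n) a t). unfold F.
    replace (t / - a) with (- (t / a)) by (field; lra).
    replace ((- a) ^ 2) with (a ^ 2) by ring.
    rewrite arcsinh_opp, !Ropp_mult_distr_r_reverse, sinh_opp, cosh_opp.
    unfold Rdiv. ring.
  - apply (is_RInt_gen_opp (F (IZR n) (- a))). now apply pos.
Qed.
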